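(* Let $K$, $U$, $\Gamma$ be as in the context. (1) For every natural number $i$, the torsion theory $(\mathcal T_i,\mathcal F_i)$ in $\Gamma$-Mod is liftable to $U$-Mod. (2) Let $M$ be a simple $U$-module. There exists a unique natural number $i$ such that $t_i(M)=M$ and $t_{i-1}(M)=0$, and in that case all prime ideals in $\operatorname{Ass}(M)$ (where $M$ is regarded as a $\Gamma$-module) have coheight exactly $i$.
   Context: $K$ is an algebraically closed field of characteristic zero. $U$ is a $K$-algebra and $\Gamma\subseteq U$ a commutative $K$-subalgebra such that: (i) $\Gamma$ is finitely generated as a $K$-algebra; (ii) there are finitely many $u_1,\dots,u_n\in U$ such that $U$ is generated as a $K$-algebra by $\Gamma\cup\{u_1,\dots,u_n\}$; (iii) for every $u\in U$, the $\Gamma$-bimodule $\Gamma u\Gamma$ is finitely generated both as a left and as a right $\Gamma$-module. Define $Z_0=\operatorname{Specm}\Gamma$ and, for $i\ge1$, $Z_i=Z_{i-1}\cup\operatorname{Max}(\operatorname{Spec}\Gamma\setminus Z_{i-1})$ ($\operatorname{Max}$ = inclusion-maximal elements); the coheight of a prime $\mathbf p$ is the least $i$ with $\mathbf p\in Z_i$ (a natural number, as $\Gamma$ has finite Krull dimension). $\mathcal T_i$ is the class of $\Gamma$-modules $T$ with $\operatorname{Supp}(T)=\{\mathbf p:T_{\mathbf p}\neq0\}\subseteq Z_i$, $\mathcal F_i=\{F:\operatorname{Hom}_\Gamma(T,F)=0\ \forall T\in\mathcal T_i\}$, and $t_i(M)$ is the largest $\Gamma$-submodule of $M$ in $\mathcal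 T_i$; convention $t_{-1}(M)=0$. A torsion theory on $\Gamma$-Mod is liftable to $U$-Mod if for every $U$-module $M$ its torsion $\Gamma$-submodule is a $U$-submodule. $\operatorname{Ass}(M)$ is the set of primes of $\Gamma$ of the form $\operatorname{ann}_\Gamma(x)$, $x\in M$. *)

(* Defs.v *)
From HB Require Import structures.
From mathcomp Require Import all_boot all_order all_algebra.
Set Implicit Arguments. Unset Strict Implicit. Unset Printing Implicit Defensive.
Import GRing.Theory.
Local Open Scope ring_scope.

(* Subsets are Prop-valued predicates.  Gamma is a subset G of U. *)

Section Defs.
Variables (K : fieldType) (U : algType K).

Definition is_subalg (P : U -> Prop) : Prop :=
  [/\ P 1, (forall x y, P x -> P y -> P (x + y)),
      (forall x y, P x -> P y -> P (x * y)) &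
      (forall (k : K) x, P x -> P (k *: x))].

Definition comm_on (G : U -> Prop) : Prop :=
  forall a b, G a -> G b -> a * b = b * a.

Definition gen_by (S G : U -> Prop) : Prop :=
  (forall x, S x -> G x) /\
  forall P, is_subalg P -> (forall x, S x -> P x) -> forall g, G g -> P g.

Definition in_GuG (G : U -> Prop) (u x : U) : Prop :=
  exists s : seq (U * U), (forall q, q \in s -> G q.1 /\ G q.2) /\
                          x = \sum_(q <- s) q.1 * u * q.2.

Definition left_span (G : U -> Prop) (v : seq U) (x : U) : Prop :=
  exists c : 'I_(size v) -> U, (forall j, G (c j)) /\
    x = \sum_(j < size v) c j * v`_j.

Definition right_span (G : U -> Prop) (v : seq U) (x : U) : Prop :=
  exists c : 'I_(size v) -> U, (forall j, G (c j)) /\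
    x = \sum_(j < size v) v`_j * c j.

Definition fg_left (G : U -> Prop) (u : U) : Prop :=
  exists v : seq U, (forall y, y \in v -> in_GuG G u y) /\
                    forall x, in_GuG G u x -> left_span G v x.
Definition fg_right (G : U -> Prop) (u : U) : Prop :=
  exists v : seq U, (forall y, y \in v -> in_GuG G u y) /\
                    forall x, in_GuG G u x -> right_span G v x.

Definition is_ideal (G p : U -> Prop) : Prop :=
  [/\ (forall x, p x -> G x), p 0,
      (forall x y, p x -> p y -> p (x + y)) &
      (forall a x, G a -> p x -> p (a * x))].

Definition is_prime (G p : U -> Prop) : Prop :=
  [/\ is_ideal G p, ~ p 1 &
      forall a b, G a -> G b -> p (a * b) -> p a \/ p b].

Definition is_maximal (G p : U -> Prop) : Prop :=
  [/\ is_ideal G p, ~ p 1 &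
      forall q, is_ideal G q -> ~ q 1 -> (forall x, p x -> q x) ->
        forall x, q x -> p x].

Fixpoint inZ (G : U -> Prop) (i : nat) (p : U -> Prop) : Prop :=
  match i with
  | 0 => is_maximal G p
  | j.+1 => inZ G j p \/
      [/\ is_prime G p, ~ inZ G j p &
          forall q, is_prime G q -> ~ inZ G j q ->
            (forall x, p x -> q x) -> forall x, q x -> p x]
  end.

Definition coheight (G p : U -> Prop) (i : nat) : Prop :=
  inZ G i p /\ forall j, (j < i)%N -> ~ inZ G j p.

Section Modules.
Variable M : lmodType U.

Definition is_Gsubmod (G : U -> Prop) (N : M -> Prop) : Prop :=
  [/\ N 0, (forall x y, N x -> N y -> N (x + y)) &
      forall a x, G a -> N x -> N (a *: x)].

Definition is_Usubmod (N : M -> Prop) : Prop :=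
  [/\ N 0, (forall x y, N x -> N y -> N (x + y)) &
      forall u x, N x -> N (u *: x)].

(* N_p <> 0 : some x/1 is nonzero in the localization at p *)
Definition loc_nonzero (G : U -> Prop) (N : M -> Prop) (p : U -> Prop) : Prop :=
  exists x, N x /\ forall s, G s -> ~ p s -> s *: x <> 0.

Definition supp_in_Z (G : U -> Prop) (i : nat) (N : M -> Prop) : Prop :=
  forall p, is_prime G p -> loc_nonzero G N p -> inZ G i p.

(* t_i(M): the largest Gamma-submodule of M lying in T_i
   (= union of all Gamma-submodules lying in T_i) *)
Definition t_ (G : U -> Prop) (i : nat) (x : M) : Prop :=
  exists N, [/\ is_Gsubmod G N, supp_in_Z G i N & N x].

Definition t_prev (G : U -> Prop) (i : nat) (x : M) : Prop :=
  match i with 0 => x = 0 | j.+1 => t_ G j x end.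

Definition simple_mod : Prop :=
  (exists x : M, x <> 0) /\
  forall N, is_Usubmod N -> (forall x, N x -> x = 0) \/ (forall x, N x).

Definition Ass (G p : U -> Prop) : Prop :=
  is_prime G p /\ exists x : M, forall g, p g <-> (G g /\ g *: x = 0).

End Modules.

Definition liftable (G : U -> Prop) (i : nat) : Prop :=
  forall M : lmodType U, is_Usubmod (t_ (M := M) G i).

End Defs.

(* Main.v *)
(* Let N be the torsion submodule t_i(M), x in N and u in U.  The operators
   w |-> sum a w b with a, b in Gamma form a commutative ring C acting on U, and
   f |-> f(u) maps C onto Gamma u Gamma.  Hence modulo the ideal of those f with
   f(u) Gamma x = 0, C is a finite Gamma-module through both left and right
   multiplications.  Chains of primes therefore transfer: going-up on the left and
   incomparability on the right bound the coheight of a prime containing the left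
   annihilator of Gamma u Gamma x by that of primes containing ann(x), so u x is
   again in t_i(M).  For simple M one takes the least i with t_i(M) <> 0; it exists
   because all coheights are bounded.  The bound comes from growth: if a chain
   P_0 < P_1 < ... < P_k is separated by x_j in P_(j+1) \ P_j, the monomials in the
   x_j are linearly independent modulo P_0, and there are too many of them when k
   exceeds the number of generators of Gamma. *)
Require Import Defs.
From HB Require Import structures.
From mathcomp Require Import all_boot all_order all_algebra.
From mathcomp Require Import ring boolp classical_sets functions.
Set Implicit Arguments. Unset Strict Implicit. Unset Printing Implicit Defensive.
Import GRing.Theory.
Local Open Scope ring_scope.

(** * Prime ideals and finite morphisms *)

Section PrimeIdeals.
Variable R : comPzRingType.
Implicit Types (I J P Q : R -> Prop) (x y a b : R).

Definition ideal I :=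
  [/\ I 0, forall x y, I x -> I y -> I (x + y) & forall a x, I x -> I (a * x)].

Definition prime_ideal P :=
  [/\ ideal P, ~ P 1 & forall a b, P (a * b) -> P a \/ P b].

Lemma idealN I x : ideal I -> I x -> I (- x).
Proof. by case=> _ _ IM Ix; rewrite -mulN1r; apply: IM. Qed.

Lemma idealB I x y : ideal I -> I x -> I y -> I (x - y).
Proof. by move=> idI Ix Iy; case: (idI) => _ ID _; apply: ID => //; apply: idealN. Qed.

Lemma prime_avoiding I (S : R -> Prop) :
  ideal I -> S 1 -> (forall x y, S x -> S y -> S (x * y)) ->
  (forall x, I x -> ~ S x) ->
  exists P, [/\ prime_ideal P, forall x, I x -> P x & forall x, P x -> ~ S x].
Proof.
move=> idI S1 SM IS.
pose good J := [/\ ideal J, forall x, I x -> J x & forall x, J x -> ~ S x].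
(* Zorn's lemma also asks for the union of the empty chain, which is the empty set and no ideal. The
   predicate therefore admits the empty set; a maximal element is not empty, since it would lie
   below [I]. *)
have [|J [gJ maxJ]] := @Zorn_bigcup R (fun J => (forall x, ~ J x) \/ good J).
  move=> F sub tot.
  have goodF J x : F J -> J x -> good J by move=> /sub[/(_ x)|].
  have [[J0 FJ0 [x0 J0x0]]|noF] := pselect (exists2 J, F J & exists x, J x); last first.
    by left=> x [J FJ Jx]; apply: noF; exists J => //; exists x.
  have [[J00 _ _] IJ0 _] := goodF _ _ FJ0 J0x0.
  right; split; [split| |].
  - by exists J0.
  - move=> x y [J FJ Jx] [J' FJ' Jy].
    have [[_ JD _] _ _] := goodF _ _ FJ Jx.
    have [[_ JD' _] _ _] := goodF _ _ FJ' Jy.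
    have [JJ'|J'J] := tot _ _ FJ FJ'.
      by exists J' => //; apply: JD' => //; apply: JJ'.
    by exists J => //; apply: JD => //; apply: J'J.
  - move=> a x [J FJ Jx]; exists J => //.
    by have [[_ _ JM] _ _] := goodF _ _ FJ Jx; apply: JM.
  - by move=> x /IJ0; exists J0.
  - by move=> x [J FJ Jx]; have [_ _ JS] := goodF _ _ FJ Jx; apply: JS.
have {}maxJ B : good B -> (forall x, J x -> B x) -> forall x, B x -> J x.
  move=> gB JB; apply: contrapT => nBJ.
  by apply: (maxJ B); [split | right].
case: gJ => [J0|gJ].
  by exfalso; apply: (J0 0); apply: (maxJ I) => [|x /J0|] //; case: idI.
have [[J0 JD JM] IJ JS] := gJ.
exists J; split=> //; split=> //; first by move/JS; apply.
(* By maximality, the ideal generated by [J] and an element [a] outside [J] meets [S]. *)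
have adjoin a : ~ J a -> exists s r j, [/\ S s, J j & s = j + r * a].
  move=> nJa; apply: contrapT => no; apply: nJa.
  apply: (maxJ (fun x => exists r j, J j /\ x = j + r * a)).
  - split; [split| |].
    + by exists 0, 0; split=> //; ring.
    + move=> x y [r [j [Jj ->]]] [r' [j' [Jj' ->]]].
      by exists (r + r'), (j + j'); split; [apply: JD | ring].
    + move=> b x [r [j [Jj ->]]].
      by exists (b * r), (b * j); split; [apply: JM | ring].
    + by move=> x Ix; exists 0, x; split; [apply: IJ | ring].
    + by move=> x [r [j [Jj xE]]] Sx; apply: no; exists x, r, j.
  - by move=> x Jx; exists 0, x; split=> //; ring.
  - by exists 1, 0; split=> //; ring.
move=> a b Jab; have [Ja|nJa] := pselect (J a); first by left.
right; apply: contrapT => nJb.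
have [s [r [j [Ss Jj sE]]]] := adjoin a nJa.
have [t [r' [j' [St Jj' tE]]]] := adjoin b nJb.
apply: (JS (s * t)); last exact: SM.
rewrite sE tE.
rewrite (_ : _ * _ = (j' + r' * b) * j + (r * a * j' + r * r' * (a * b))); last by ring.
by apply: (JD); [apply: (JM) | apply: JD; apply: (JM)].
Qed.

(* For a prime P: the coheight of P is less than k. *)
Fixpoint cohlt k P := if k is j.+1 then
    forall Q, prime_ideal Q -> (forall x, P x -> Q x) ->
      (forall x, Q x -> P x) \/ cohlt j Q
  else False.

Lemma cohltS k P : cohlt k P -> cohlt k.+1 P.
Proof.
elim: k P => [//|k IH] P cP Q pQ PQ.
by case: (cP Q pQ PQ) => [|/IH]; [left | right].
Qed.

End PrimeIdeals.

(** * Going-up and incomparability for finite ring morphisms *)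

Section FiniteMorphism.
Variables (A C : comPzRingType) (phi : {rmorphism A -> C}).
Implicit Types (p : A -> Prop) (I P : C -> Prop) (vs : seq C).

(* [x] belongs to [I + sum_(v <- vs) phi p * v]. *)
Fixpoint span p I vs (x : C) := if vs is v :: vs' then
    exists2 c, p c & span p I vs' (x - phi c * v)
  else I x.

(** For an ideal [I] this says that the quotient of [C] by [I] is a finitely generated [A]-module
    through [phi]. *)
Definition finite_mod I := exists vs, forall x, span (fun=> True) I vs x.

Lemma spanD p I vs x y : ideal p -> ideal I ->
  span p I vs x -> span p I vs y -> span p I vs (x + y).
Proof.
move=> [_ pD _] [_ ID _]; elim: vs x y => [|v vs IH] x y /=; first exact: ID.
move=> [c pc sx] [d pd sy]; exists (c + d); first exact: pD.
by rewrite (_ : _ - _ = (x - phi c * v) + (y - phi d * v)); [exact: IH | rewrite rmorphD; ring].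
Qed.

Lemma spanZ p I vs (p' : A -> Prop) a x : (forall c, p c -> p' (a * c)) -> ideal I ->
  span p I vs x -> span p' I vs (phi a * x).
Proof.
move=> pM [_ _ IM]; elim: vs x => [|v vs IH] x /=; first exact: IM.
move=> [c pc sx]; exists (a * c); first exact: pM.
by rewrite (_ : _ - _ = phi a * (x - phi c * v)); [exact: IH | rewrite rmorphM; ring].
Qed.

Lemma span_base p I vs x : p 0 -> I x -> span p I vs x.
Proof.
move=> p0; elim: vs x => [//|v vs IH] x Ix /=.
by exists 0 => //; rewrite rmorph0 mul0r subr0; apply: IH.
Qed.

Lemma span_sum I vs x (c : nat -> A) :
  I (x - \sum_(i < size vs) phi (c i) * vs`_i) -> span (fun=> True) I vs x.
Proof.
elim: vs x c => [|v vs IH] x c /=; first by rewrite big_ord0 subr0.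
rewrite big_ord_recl opprD addrA => Ix.
by exists (c 0%N) => //; apply: (IH _ (c \o S)).
Qed.

Lemma span_annihilated p I vs a x : ideal I -> {in vs, forall v, I (phi a * v)} ->
  span p I vs x -> I (phi a * x).
Proof.
move=> idI; have [_ ID IM] := idI; elim: vs x => [|v vs IH] x av /=; first exact: IM.
move=> [c pc sx]; rewrite (_ : _ * _ = phi a * (x - phi c * v) + phi c * (phi a * v)).
  apply: ID; last by apply: IM; apply: av; rewrite mem_head.
  by apply: IH => // w vw; apply: av; rewrite inE vw orbT.
by ring.
Qed.

(* Eliminating the generators one at a time replaces the determinant trick. *)
Lemma span_stable p I vs a : prime_ideal p -> ideal I -> ~ p a ->
  {in vs, forall v, span p I vs (phi a * v)} ->
  exists2 d, ~ p d & {in vs, forall v, I (phi d * v)}.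
Proof.
move=> [idp _ pP] idI; have [_ _ pM] := idp.
elim: vs a => [|v vs IH] a npa sv; first by exists a.
have /= [c pc scv] := sv v (mem_head _ _).
have npac : ~ p (a - c).
  by case: idp => _ pD _ pac; apply: npa; rewrite -(subrK c a); apply: pD.
have sacv : span p I vs (phi (a - c) * v) by rewrite rmorphB mulrBl.
(* Modulo [I], [phi (a - c) * v] involves only the remaining generators. Multiplying their relations
   by [a - c] thus eliminates [v] and keeps all coefficients in [p]. *)
have [/pP[]//|w vw|d npd dI] := IH ((a - c) * a).
  have /= [|e pe se] := sv w; first by rewrite inE vw orbT.
  rewrite (_ : _ * w = phi (a - c) * (phi a * w - phi e * v) + phi e * (phi (a - c) * v)).
    by apply: spanD => //; [apply: (spanZ _ idI se) | apply: (spanZ _ idI sacv)] => c'; apply: pM.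
  by rewrite rmorphM; ring.
exists (d * (a - c)) => [/pP[]//|w]; rewrite inE rmorphM => /predU1P[->|vw].
  by rewrite -mulrA; apply: span_annihilated sacv.
by rewrite mulrAC mulrC; case: idI => _ _ IM; apply: IM; apply: dI.
Qed.

(** Prime avoidance for the ideal generated by [I] and [phi p], against the image of the complement
    of [p]. If they met in [phi a], then [phi a] would map every generator into the [p]-span. By
    [span_stable] some [d] outside [p] would kill all generators modulo [I], hence also 1, and
    [phi d] would lie in [I], forcing [d] into [p]. *)
Lemma going_up I p : ideal I -> finite_mod I -> prime_ideal p ->
  (forall a, I (phi a) -> p a) ->
  exists P, [/\ prime_ideal P, forall x, I x -> P x & forall a, P (phi a) <-> p a].
Proof.
move=> idI [vs fin] prp Ip; have [idp np1 pP] := prp; have [p0 pD pM] := idp.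
have spanpM c x : p c -> span p I vs (phi c * x).
  move=> pc; apply: (spanZ _ idI (fin x)) => d _; rewrite mulrC; exact: pM.
have spanM ws y x : span p I ws x -> span p I vs (y * x).
  elim: ws x => [|w ws IH] x /=.
    by move=> Ix; apply: span_base => //; case: idI => _ _; apply.
  move=> [c pc /IH sx]; rewrite (_ : _ * x = y * (x - phi c * w) + phi c * (y * w)).
    by apply: spanD => //; apply: spanpM.
  by ring.
have [||||P [prP IP PS]] := @prime_avoiding C (span p I vs) (fun x => exists2 a, ~ p a & x = phi a).
- by split=> [|x y|a x]; [apply: span_base => //; case: idI | apply: spanD | apply: spanM].
- by exists 1 => //; rewrite rmorph1.
- by move=> _ _ [a npa ->] [b npb ->]; exists (a * b); [case/pP | rewrite rmorphM].
- move=> x sx [a npa xE]; move: sx; rewrite xE => sa.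
  have [v _|d npd dI] := span_stable prp idI npa (vs := vs); first by rewrite mulrC; apply: spanM sa.
  by apply/npd/Ip; rewrite -[phi d]mulr1; apply: span_annihilated dI (fin 1).
exists P; split=> // [x Ix|a]; first by apply/IP/span_base.
split=> [Pa|pa]; last by apply: IP; rewrite -[phi a]mulr1; apply: spanpM.
by apply: contrapT => npa; apply: PS Pa _; exists a.
Qed.

(* Fraction-free Gaussian elimination over the domain A / phi^-1(P). *)
Lemma span_dependent P vs (xs : 'I_(size vs).+1 -> C) : prime_ideal P ->
  (forall k, span (fun=> True) P vs (xs k)) ->
  exists b : 'I_(size vs).+1 -> A,
    (exists k, ~ P (phi (b k))) /\ P (\sum_k phi (b k) * xs k).
Proof.
move=> [idP nP1 PP]; have [P0 PD PM] := idP.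
elim: vs xs => [|v vs IH] xs sxs /=.
  exists (fun=> 1); split; first by exists ord0; rewrite rmorph1.
  by rewrite big_ord1 rmorph1 mul1r; apply: (sxs ord0).
have [c Hc] := choice (fun k => (let: ex_intro2 c _ h := sxs k in ex_intro _ c h) :
  exists c, span (fun=> True) P vs (xs k - phi c * v)).
have [k0 [e [Pe sy]]] : exists (k0 : 'I_(size vs).+2) e, ~ P (phi e) /\ forall i : 'I_(size vs).+1,
    exists f, span (fun=> True) P vs (phi e * xs (lift k0 i) - phi f * xs k0).
  (* A row whose coefficient at [v] is nonzero modulo [P] serves as pivot. If there is none, [v]
     contributes nothing modulo [P], and the first row is dropped with multiplier 1. *)
  have [[k0 nPc]|Pc] := pselect (exists k0, ~ P (phi (c k0))).
    exists k0, (c k0); split=> // i; exists (c (lift k0 i)).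
    rewrite (_ : _ - _ = phi (c k0) * (xs (lift k0 i) - phi (c (lift k0 i)) * v)
              + phi (- c (lift k0 i)) * (xs k0 - phi (c k0) * v)); last by rewrite rmorphN; ring.
    by apply: spanD => //; apply: (spanZ _ idP (Hc _)).
  exists ord0, 1; split=> [|i]; first by rewrite rmorph1.
  exists 0; rewrite rmorph1 rmorph0 mul1r mul0r subr0.
  rewrite -(subrK (phi (c (lift ord0 i)) * v) (xs _)); apply: spanD => //.
  apply: span_base => //; rewrite mulrC; apply: PM.
  by apply: contrapT => nPc; apply: Pc; exists (lift ord0 i).
have [f Hf] := choice sy.
have [b [[i nPb] Pb]] := IH _ Hf.
exists (fun k => if unlift k0 k is Some i then b i * e else - \sum_i b i * f i).
split; first by exists (lift k0 i); rewrite liftK rmorphM => /PP[].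
rewrite (@bigD1_ord _ _ _ _ k0) //= unlift_none.
rewrite rmorphN rmorph_sum mulNr mulr_suml addrC -sumrB.
rewrite (eq_bigr (fun k => phi (b k) * (phi e * xs (lift k0 k) - phi (f k) * xs k0))) //.
by move=> j _; rewrite liftK !rmorphM; ring.
Qed.

(** Take [s] in [P'] but not in [P]. Finiteness gives a nontrivial relation modulo [P] among powers
    of [s]. Its constant coefficient lies in [P'], hence in [P]; as [P] is prime, a factor [s]
    cancels, and by induction every coefficient lies in [P], a contradiction. *)
Lemma incomparability P P' : prime_ideal P -> prime_ideal P' -> finite_mod P ->
  (forall x, P x -> P' x) -> (forall a, P' (phi a) -> P (phi a)) ->
  forall x, P' x -> P x.
Proof.
move=> prP [idP' _ _] [vs fin] PP' con s P's; apply: contrapT => nPs.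
have [idP _ PP] := prP.
have coefs n (b : 'I_n -> A) : P (\sum_(k < n) phi (b k) * s ^+ k) -> forall k, P (phi (b k)).
  elim: n b => [|n IH] b; first by move=> _ [].
  rewrite big_ord_recl /= expr0 mulr1.
  rewrite (_ : \sum_(i < n) _ = s * \sum_(i < n) phi (b (lift ord0 i)) * s ^+ i); last first.
    by rewrite mulr_sumr; apply: eq_bigr => j _; rewrite exprS; ring.
  set t := \sum_(i < n) _ => Pb0.
  have Pbs : P (phi (b ord0)).
    apply: con; rewrite -[phi _](addrK (s * t)); apply: idealB => //; first exact: PP'.
    by rewrite mulrC; case: idP' => _ _; apply.
  have /PP[//|/IH Pb] : P (s * t) by rewrite -[_ * t](addKr (phi (b ord0))) addrC; apply: idealB.
  by move=> k; case: (unliftP ord0 k) => [j|] ->.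
have [b [[k nPb] Pb]] := span_dependent prP (fun k : 'I_(size vs).+1 => fin (s ^+ k)).
exact: nPb (coefs _ _ Pb k).
Qed.

End FiniteMorphism.

(** * Comparing coheights along two finite morphisms into the same ring *)

Section Bimodule.
Variables (A C : comPzRingType) (phi psi : {rmorphism A -> C}).

Lemma finite_modW (chi : {rmorphism A -> C}) (I J : C -> Prop) :
  (forall x, I x -> J x) -> finite_mod chi I -> finite_mod chi J.
Proof.
move=> IJ [vs fin]; exists vs => x; elim: vs x {fin}(fin x) => [|v vs IH] x /=; first exact: IJ.
by move=> [c _ /IH]; exists c.
Qed.

Lemma prime_preim (chi : {rmorphism A -> C}) P : prime_ideal P -> prime_ideal (P \o chi).
Proof.
move=> [[P0 PD PM] nP1 PP]; split; rewrite /= ?rmorph1 //; last by move=> a b; rewrite rmorphM; apply: PP.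
by split=> [|x y|a x]; rewrite /= ?rmorph0 ?rmorphD ?rmorphM; auto.
Qed.

(** A prime [q] above [P \o phi] lifts by going-up to some [P'] above [P]. If [P'] and [P] have the
    same preimage under [psi], incomparability along [psi] gives [P' = P], so [q] is no larger than
    [P \o phi]. Otherwise the bound at [P' \o psi] has dropped by one and the induction hypothesis
    applies to [P']. *)
Lemma cohlt_transfer k P : prime_ideal P -> finite_mod phi P -> finite_mod psi P ->
  cohlt k (P \o psi) -> cohlt k (P \o phi).
Proof.
elim: k P => [//|k IH] P prP fphi fpsi cP q prq Pq.
have idP : ideal P by case: prP.
have [P' [prP' PP' P'q]] := going_up idP fphi prq Pq.
have [P'P|] := cP (P' \o psi) (prime_preim _ prP') (fun a => PP' _).
  left=> a qa; apply: (incomparability prP prP' fpsi PP' P'P).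
  exact/P'q.
right; rewrite (_ : q = P' \o phi); last by apply: funext => a; apply: propext; split=> /P'q.
by apply: IH => //; apply: finite_modW PP' _.
Qed.

Lemma cohlt_bimodule k (I : C -> Prop) :
  ideal I -> finite_mod phi I -> finite_mod psi I ->
  (forall q, prime_ideal q -> (forall a, I (psi a) -> q a) -> cohlt k q) ->
  forall p, prime_ideal p -> (forall a, I (phi a) -> p a) -> cohlt k p.
Proof.
move=> idI fphi fpsi Ik p prp Ip.
have [P [prP IP Pp]] := going_up idI fphi prp Ip.
rewrite (_ : p = P \o phi); last by apply: funext => a; apply: propext; split=> /Pp.
apply: cohlt_transfer => //; [exact: finite_modW IP _ | exact: finite_modW IP _ |].
by apply: Ik => [|a /IP//]; apply: prime_preim.
Qed.

End Bimodule.

(** * Krull dimension of a finitely generated algebra *)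

Section Growth.
Variables (K : fieldType) (R : comAlgType K) (n : nat) (g : 'I_n -> R).
Implicit Types (p : R -> Prop) (x y : R).

Definition subspace p :=
  [/\ p 0, forall x y, p x -> p y -> p (x + y) & forall (k : K) x, p x -> p (k *: x)].

Definition monomial (e : 'I_n -> nat) := \prod_i g i ^+ e i.

(* An intersection of subspaces rather than explicit sums, so that products need
   no reindexing. *)
Definition monspan D x := forall p, subspace p ->
  (forall e, (forall i, e i <= D)%N -> p (monomial e)) -> p x.

Lemma monspan_subspace D : subspace (monspan D).
Proof.
split=> [p [] //|x y sx sy p sp mp|k x sx p sp mp]; case: (sp) => _ pD pZ.
  by apply: pD; [apply: sx | apply: sy].
by apply: pZ; apply: sx.
Qed.

Lemma monspanW D D' x : (D <= D')%N -> monspan D x -> monspan D' x.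
Proof.
move=> leD sx p sp mp; apply: sx => // e eD; apply: mp => i.
exact: leq_trans (eD i) leD.
Qed.

Lemma monspanM D D' x y : monspan D x -> monspan D' y -> monspan (D + D') (x * y).
Proof.
move=> sx sy; have [V0 VD VZ] := monspan_subspace (D + D').
apply: (sy (fun y => monspan (D + D') (x * y))) => [|e' e'D].
  split=> [|y1 y2|k y1]; rewrite ?mulr0 ?mulrDr -?scalerAr //; [exact: VD | exact: VZ].
apply: (sx (fun x => monspan (D + D') (x * monomial e'))) => [|e eD].
  split=> [|y1 y2|k y1]; rewrite ?mul0r ?mulrDl -?scalerAl //; [exact: VD | exact: VZ].
move=> p _ mp; rewrite /monomial -big_split /=.
rewrite (eq_bigr (fun i => g i ^+ (e i + e' i))) => [|i _]; last by rewrite exprD.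
by apply: mp => i; apply: leq_add.
Qed.

Lemma monspan1 D : monspan D 1.
Proof.
move=> p _ mp; rewrite (_ : 1 = monomial (fun=> 0%N)); first exact: mp.
by rewrite /monomial big1.
Qed.

Lemma monspanX D x m i : (i <= m)%N -> monspan D x -> monspan (D * m) (x ^+ i).
Proof.
move=> im sx; apply: (@monspanW (D * i)); first by rewrite leq_mul2l im orbT.
elim: i {im} => [|i IH]; first exact: monspan1.
by rewrite exprS mulnS; apply: monspanM.
Qed.

Lemma monspan_gen i : monspan 1 (g i).
Proof.
move=> p _ mp; rewrite (_ : g i = monomial (fun j => (j == i) : nat)).
  by apply: mp => j; case: eqP.
rewrite /monomial (bigD1 i) //= eqxx expr1 big1 ?mulr1 // => j /negPf ->.
by rewrite expr0.
Qed.

Lemma monspan_coord D x : monspan D x ->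
  exists a : {ffun 'I_n -> 'I_D.+1} -> K, x = \sum_e a e *: monomial (fun i => e i).
Proof.
move=> sx; pose Q y := exists a : {ffun 'I_n -> 'I_D.+1} -> K, y = \sum_e a e *: monomial (fun i => e i).
apply: (sx Q) => [|e eD]; first split=> [|x1 x2 [a ->] [b ->]|k x1 [a ->]].
- by exists (fun=> 0); rewrite big1 // => e _; rewrite scale0r.
- exists (fun e => a e + b e); rewrite -big_split.
  by apply: eq_bigr => e _; rewrite scalerDl.
- exists (fun e => k * a e); rewrite scaler_sumr.
  by apply: eq_bigr => e _; rewrite scalerA.
- pose f : {ffun 'I_n -> 'I_D.+1} := [ffun i => inord (e i)].
  exists (fun e' => (e' == f)%:R).
  rewrite (bigD1 f) //= eqxx scale1r big1 ?addr0 => [|e' /negPf->]; last by rewrite scale0r.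
  by apply: eq_bigr => i _; rewrite ffunE inordK // ltnS.
Qed.

Definition free_mod p (T : finType) (b : T -> R) :=
  forall c : T -> K, p (\sum_t c t *: b t) -> forall t, c t = 0.

(** There are [D.+1 ^ n] monomials with all exponents at most [D]. With more vectors than that, the
    matrix of coordinates has a nonzero row in its left kernel, which is a linear relation among the
    [b t]. *)
Lemma free_mod_card p (T : finType) (b : T -> R) D : p 0 -> free_mod p b ->
  (forall t, monspan D (b t)) -> (#|T| <= D.+1 ^ n)%N.
Proof.
move=> p0 free sb; rewrite leqNgt; apply/negP => big.
have [a Ha] := choice (fun t => monspan_coord (sb t)).
pose E := {ffun 'I_n -> 'I_D.+1}.
have cE : #|E| = (D.+1 ^ n)%N by rewrite card_ffun !card_ord.
pose M : 'M[K]_(#|T|, #|E|) := \matrix_(i, j) a (enum_val i) (enum_val j).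
have kM : kermx M != 0.
  by rewrite kermx_eq0 /row_free neq_ltn (leq_ltn_trans (rank_leq_col M)) ?cE.
pose v := nz_row (kermx M).
have vM : v *m M = 0 by apply/sub_kermxP/nz_row_sub.
have v0 : v = 0.
  apply/rowP => i; rewrite mxE -(enum_valK i).
  apply: (free (fun t => v 0 (enum_rank t))); rewrite (_ : \sum_t _ = 0) //.
  rewrite (eq_bigr (fun t => \sum_e (v 0 (enum_rank t) * a t e) *: monomial (fun i => e i))).
    rewrite exchange_big big1 // => e _; rewrite -scaler_suml.
    rewrite (_ : \sum_t _ = (v *m M) 0 (enum_rank e)); first by rewrite vM mxE scale0r.
    rewrite mxE (reindex (@enum_val T T)); last exact: onW_bij (enum_val_bij T).
    by apply: eq_bigr => j _; rewrite !mxE enum_valK enum_rankK.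
  move=> t _; rewrite [in LHS]Ha scaler_sumr.
  by apply: eq_bigr => e _; rewrite scalerA.
by move: kM; rewrite -nz_row_eq0 -/v v0 eqxx.
Qed.

(** In a relation modulo [p], every term with a positive power of [x] vanishes modulo [q], so
    freeness modulo [q] kills the coefficients of [x ^+ 0]. The rest is divisible by [x], which
    cancels because [p] is prime and [x] is outside it. *)
Lemma free_mod_powers p q (T : finType) (b : T -> R) x m :
  prime_ideal p -> ideal q -> (forall y, p y -> q y) -> q x -> ~ p x ->
  free_mod q b -> free_mod p (fun it : 'I_m * T => x ^+ it.1 * b it.2).
Proof.
move=> [[p0 _ _] _ pP] idq pq qx npx free c.
rewrite (_ : \sum_it _ = \sum_(i < m) \sum_t c (i, t) *: (x ^+ i * b t)); last first.
  by rewrite pair_bigA; apply: eq_bigr => -[].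
rewrite (eq_bigr (fun i : 'I_m => x ^+ i * \sum_t c (i, t) *: b t)); last first.
  by move=> i _; rewrite mulr_sumr; apply: eq_bigr => t _; rewrite scalerAr.
move=> pc [i t]; elim: m c pc i => [|m IH] c pc i; first by case: i.
move: pc; rewrite big_ord_recl expr0 mul1r.
rewrite (eq_bigr (fun i : 'I_m => x * (x ^+ i * \sum_t c (lift ord0 i, t) *: b t))); last first.
  by move=> j _; rewrite mulrA -exprS.
rewrite -mulr_sumr => pc.
have c0 t' : c (ord0, t') = 0.
  apply: (free (fun t => c (ord0, t))).
  set y := \sum_t _ in pc *; rewrite -[y](addrK (x * \sum_(i < m) x ^+ i * \sum_t c (lift ord0 i, t) *: b t)).
  apply: idealB => //; first exact: pq.
  by rewrite mulrC; case: idq => _ _; apply.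
move: pc; rewrite big1 => [|t' _]; last by rewrite c0 scale0r.
rewrite add0r => /pP[//|pc]; case: (unliftP ord0 i) => [j|] ->; last exact: c0.
exact: (IH (fun it => c (lift ord0 it.1, it.2))).
Qed.

Hypothesis monspan_exhaustive : forall x, exists D, monspan D x.

(** A chain of [k] strict inclusions above [p] yields [m ^ k] independent products of powers below
    [m] of the separating elements. The constant [d] adds up the exponent bounds of these elements
    and does not depend on [m]. *)
Lemma free_mod_growth k p : prime_ideal p -> ~ cohlt k p ->
  exists d, forall m, exists (T : finType) (b : T -> R),
    [/\ #|T| = (m ^ k)%N, forall t, monspan (d * m) (b t) & free_mod p b].
Proof.
elim: k p => [|k IH] p prp ncp.
  exists 0%N => m; exists unit, (fun=> 1); split=> [||c pc []]; first by rewrite card_unit.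
    by move=> _; apply: monspan1.
  case: prp => [[_ _ pM] np1 _]; apply: contra_notP np1 => /eqP c0.
  move: pc; rewrite (bigD1 tt) //= big1 => [|[]//].
  by rewrite addr0 => /(pM ((c tt)^-1)%:A); rewrite mulr_algl scalerA mulVf ?scale1r.
have [q [prq pq [x qx npx] ncq]] : exists q, [/\ prime_ideal q, forall y, p y -> q y,
    exists2 x, q x & ~ p x & ~ cohlt k q].
  apply: contra_notP ncp => no q prq pq.
  have [|nqp] := pselect (forall x, q x -> p x); [by left|right].
  apply: contrapT => ncq; apply: no; exists q; split=> //.
  apply: contrapT => nx; apply: nqp => x qx; apply: contrapT => npx.
  by apply: nx; exists x.
have [d Hd] := IH q prq ncq; have [D sx] := monspan_exhaustive x.
exists (D + d)%N => m; have [T [b [cT sb fb]]] := Hd m.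
exists ('I_m * T)%type, (fun it : 'I_m * T => x ^+ it.1 * b it.2); split.
- by rewrite card_prod card_ord cT expnS.
- by move=> [i t]; rewrite mulnDl; apply: monspanM => //; apply: monspanX => //; apply: ltnW.
- by case: (prq) => idq _ _; apply: free_mod_powers fb.
Qed.

Lemma cohlt_bounded p : prime_ideal p -> cohlt n.+1 p.
Proof.
move=> prp; apply: contrapT => /(free_mod_growth prp)[d Hd].
(* This [m] exceeds [d.+1 ^ n]. Hence [(d * m).+1 ^ n] is at most [d.+1 ^ n * m ^ n], which is less
   than [m ^ n.+1], against the bound on independent families. *)
have [T [b [cT sb fb]]] := Hd ((d.+1 ^ n).+1).
have p0 : p 0 by case: prp => [[]].
have := free_mod_card p0 fb sb; rewrite cT leqNgt => /negP; apply.
set m := (d.+1 ^ n).+1%N; apply: (@leq_ltn_trans ((d.+1 * m) ^ n)).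
  by case: (n) => [//|n']; rewrite leq_exp2r // mulSn  -add1n leq_add2r.
by rewrite expnMn expnS ltn_pmul2r ?expn_gt0.
Qed.

End Growth.

(** * Restriction to a commutative subalgebra *)

Section CommutativeSubalgebra.
Variables (K : fieldType) (U : algType K) (G : U -> Prop).
Hypotheses (Gsub : is_subalg G) (Gcomm : comm_on G).

(* The unused proof arguments let canonical structures recover them from the type. *)
Definition subalg_pred of is_subalg G & comm_on G : {pred U} := fun x => `[< G x >].
Notation Gb := (subalg_pred Gsub Gcomm).

Lemma subalg_predP x : reflect (G x) (x \in Gb).
Proof. rewrite unfold_in; exact: asboolP. Qed.

Lemma subalg_pred_closed : GRing.subsemialg_closed Gb.
Proof.
have [G1 GD GM GZ] := Gsub.
split; [|split| |].
- exact/subalg_predP.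
- by apply/subalg_predP; rewrite -(scale0r 1); apply: GZ.
- by move=> x y /subalg_predP Gx /subalg_predP Gy; apply/subalg_predP/GD.
- by move=> k x /subalg_predP Gx; apply/subalg_predP/GZ.
- by move=> x y /subalg_predP Gx /subalg_predP Gy; apply/subalg_predP/GM.
Qed.
HB.instance Definition _ := GRing.isSubalgClosed.Build K U Gb subalg_pred_closed.

Definition subalg_type := {x : U | x \in Gb}.
HB.instance Definition _ := SubType.on subalg_type.
HB.instance Definition _ := [Choice of subalg_type by <:].
HB.instance Definition _ := [SubChoice_isSubAlgebra of subalg_type by <:].

Lemma subalg_valP (a : subalg_type) : G (val a).
Proof. exact/subalg_predP/valP. Qed.

Lemma subalg_mulC : commutative (@GRing.mul subalg_type).
Proof.
by move=> a b; apply: val_inj; apply: Gcomm (subalg_valP a) (subalg_valP b).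
Qed.
HB.instance Definition _ :=
  GRing.PzRing_hasCommutativeMul.Build subalg_type subalg_mulC.

Local Notation A := subalg_type.

Lemma subalg_lift x : G x -> exists a : A, val a = x.
Proof. by move=> /subalg_predP Gx; exists (Sub x Gx); rewrite SubK. Qed.

(** The definitions of the theorem treat ideals of [G] as predicates on [U], while the ring theory
    above works on a commutative ring type. These two maps translate between both views. *)
Definition ideal_in (p : U -> Prop) (a : A) := p (val a).
Definition ideal_out (P : A -> Prop) (x : U) := exists2 a : A, P a & val a = x.

Lemma ideal_outK P : ideal_in (ideal_out P) = P.
Proof.
apply: funext => a; apply: propext; split=> [[b Pb /val_inj <-//]|Pa].
by exists a.
Qed.

Lemma ideal_inP p : is_ideal G p -> ideal (ideal_in p).
Proof.
move=> [_ p0 pD pM]; split=> [|a b|a b]; rewrite /ideal_in ?rmorph0 ?rmorphD ?rmorphM //.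
  exact: pD.
by apply: pM; apply: subalg_valP.
Qed.

Lemma prime_in p : is_prime G p -> prime_ideal (ideal_in p).
Proof.
move=> [idp np1 pP]; split; first exact: ideal_inP.
  by rewrite /ideal_in rmorph1.
by move=> a b; rewrite /ideal_in rmorphM; apply: pP; apply: subalg_valP.
Qed.

Lemma prime_out P : prime_ideal P -> is_prime G (ideal_out P).
Proof.
move=> [[P0 PD PM] nP1 PP]; split; first split.
- by move=> _ [a _ <-]; apply: subalg_valP.
- by exists 0; rewrite ?rmorph0.
- by move=> _ _ [a Pa <-] [b Pb <-]; exists (a + b); [apply: PD | rewrite rmorphD].
- move=> _ _ /subalg_lift[a <-] [b Pb <-].
  by exists (a * b); [apply: PM | rewrite rmorphM].
- by case=> a Pa a1; apply: nP1; rewrite (_ : 1 = a) //; apply: val_inj; rewrite a1 rmorph1.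
- move=> _ _ /subalg_lift[a <-] /subalg_lift[b <-] [c Pc]; rewrite -rmorphM => /val_inj cE.
  by move: Pc; rewrite cE => /PP[Pa|Pb]; [left; exists a | right; exists b].
Qed.

Lemma prime_above q : is_ideal G q -> ~ q 1 ->
  exists2 P, prime_ideal P & forall a, ideal_in q a -> P a.
Proof.
move=> idq nq1; have [||||P [prP qP _]] := @prime_avoiding A (ideal_in q) (eq 1).
- exact: ideal_inP.
- by [].
- by move=> _ _ <- <-; rewrite mulr1.
- by move=> a qa a1; apply: nq1; move: qa; rewrite -a1 /ideal_in rmorph1.
by exists P.
Qed.

(** The bound is [i.+1] because [cohlt] is strict. At level 0, every proper ideal lies in a prime,
    so being maximal among primes means being a maximal ideal. At the next level, a prime outside
    [inZ G i] is maximal there exactly when all strictly larger primes lie in [inZ G i]. *)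
Lemma inZ_cohlt i p : inZ G i p <-> is_prime G p /\ cohlt i.+1 (ideal_in p).
Proof.
elim: i p => [|i IH] p.
  split=> [[idp np1 maxp]|[prp cp]].
    have outM P : prime_ideal P -> (forall a, ideal_in p a -> P a) ->
        forall x, ideal_out P x -> p x.
      move=> /prime_out[idP nP1 _] pP; apply: maxp => // x px.
      have [a aE] := subalg_lift (let: And4 pG _ _ _ := idp in pG x px).
      by exists a => //; apply: pP; rewrite /ideal_in aE.
    have [P prP pP] := prime_above idp np1.
    have pE : p = ideal_out P.
      apply: funext => x; apply: propext; split; last exact: outM.
      move=> px; have [a aE] := subalg_lift (let: And4 pG _ _ _ := idp in pG x px).
      by exists a => //; apply: pP; rewrite /ideal_in aE.
    split=> [|Q prQ pQ]; first by rewrite pE; apply: prime_out.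
    by left=> a Qa; apply: (outM Q) => //; exists a.
  case: (prp) => idp np1 _; split=> // q idq nq1 pq x qx.
  have [P prP qP] := prime_above idq nq1.
  have [a aE] := subalg_lift (let: And4 qG _ _ _ := idq in qG x qx).
  have [|Pp|//] := cp P prP; first by move=> b /pq/qP.
  by rewrite -aE; apply: Pp; apply: qP; rewrite /ideal_in aE.
split=> [[/IH[prp cp]|[prp npi maxp]]|[prp cp]].
- by split=> //; apply: cohltS.
- split=> // Q prQ pQ.
  have [/IH[_]|nQ] := pselect (inZ G i (ideal_out Q)); first by rewrite ideal_outK; right.
  left=> a Qa; apply: (maxp _ (prime_out prQ) nQ); last by exists a.
  move=> x px; have [a' aE] := subalg_lift (let: And3 (And4 pG _ _ _) _ _ := prp in pG x px).
  by exists a' => //; apply: pQ; rewrite /ideal_in aE.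
- have [|npi] := pselect (inZ G i p); [by left | right; split=> // q prq nqi pq x qx].
  have [a aE] := subalg_lift (let: And3 (And4 qG _ _ _) _ _ := prq in qG x qx).
  have [||cq] := cp (ideal_in q) (prime_in prq); first by move=> b; apply: pq.
    by rewrite -aE; apply; rewrite /ideal_in aE.
  by case: nqi; apply/IH.
Qed.

Lemma inZ_up i p q : is_prime G q -> inZ G i p -> (forall x, p x -> q x) -> inZ G i q.
Proof.
move=> prq /inZ_cohlt[prp cp] pq; apply/inZ_cohlt; split=> //.
have [||] := cp (ideal_in q) (prime_in prq); first by move=> b; apply: pq.
  move=> qp; rewrite (_ : ideal_in q = ideal_in p) //.
  by apply: funext => a; apply: propext; split=> [/qp|/pq].
exact: cohltS.
Qed.

Lemma inZ_bounded (s : seq U) : gen_by (fun x => x \in s) G ->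
  forall p, is_prime G p -> inZ G (size s) p.
Proof.
move=> [sG gen] p prp; apply/inZ_cohlt; split=> //.
have [g gE] := choice (fun i : 'I_(size s) => subalg_lift (sG _ (mem_nth 0 (ltn_ord i)))).
apply: (@cohlt_bounded _ _ _ g); last exact: prime_in.
(* The elements lying in some [monspan g D] form a subalgebra containing the generators, hence they
   exhaust [G]. *)
move=> a; pose P x := exists2 b : A, val b = x & exists D, monspan g D b.
have subP : is_subalg P.
  split.
  - by exists 1; rewrite ?rmorph1 //; exists 0%N; apply: monspan1.
  - move=> _ _ [b <- [D sb]] [c <- [D' sc]]; exists (b + c); first by rewrite rmorphD.
    exists (D + D')%N; have [_ VD _] := monspan_subspace g (D + D').
    by apply: VD; [apply: monspanW sb | apply: monspanW sc]; rewrite ?leq_addr ?leq_addl.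
  - move=> _ _ [b <- [D sb]] [c <- [D' sc]]; exists (b * c); first by rewrite rmorphM.
    by exists (D + D')%N; apply: monspanM.
  - move=> k _ [b <- [D sb]]; exists (k *: b); first by rewrite linearZ.
    by exists D; have [_ _ VZ] := monspan_subspace g D; apply: VZ.
have [x xs|b /val_inj <- //] := gen P subP _ _ (subalg_valP a).
exists (g (Ordinal (etrans (index_mem x s) xs))); first by rewrite gE nth_index.
by exists 1%N; apply: monspan_gen.
Qed.

(** * The commutative ring of two-sided multiplication operators *)

Definition biop (s : seq (A * A)) (w : U) : U :=
  \sum_(q <- s) val q.1 * w * val q.2.

Lemma biopC s t w : biop s (biop t w) = biop t (biop s w).
Proof.
have biop2 s' t' : biop s' (biop t' w) =
    \sum_(q <- s') \sum_(r <- t') val (q.1 * r.1) * w * val (q.2 * r.2).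
  apply: eq_bigr => q _; rewrite mulr_sumr mulr_suml; apply: eq_bigr => r _.
  by rewrite [q.2 * _]mulrC !rmorphM !mulrA.
rewrite !biop2 exchange_big; apply: eq_bigr => q _; apply: eq_bigr => r _.
by rewrite (mulrC r.1) (mulrC r.2).
Qed.

(** This is the image of the tensor square of Gamma in the endomorphisms of [U]. Taken as actual
    functions, its elements inherit associativity and distributivity from composition, and
    commutativity is [biopC]. *)
Definition biop_pred : {pred U -> U} := fun f => `[< exists s, f = biop s >].

Lemma biop_predP f : reflect (exists s, f = biop s) (f \in biop_pred).
Proof. rewrite unfold_in; exact: asboolP. Qed.

Lemma biop_zmod_closed : zmod_closed biop_pred.
Proof.
split=> [|_ _ /biop_predP[s ->] /biop_predP[t ->]]; apply/biop_predP.
  by exists [::]; apply: funext => w; rewrite /biop big_nil.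
exists (s ++ [seq (- q.1, q.2) | q <- t]); apply: funext => w.
rewrite /biop big_cat big_map /= -[LHS]/(biop s w - biop t w) -sumrN.
by congr (_ + _); apply: eq_bigr => q _; rewrite /= !mulNr.
Qed.
HB.instance Definition _ := GRing.isZmodClosed.Build _ biop_pred biop_zmod_closed.

Definition biop_ring := {f : U -> U | f \in biop_pred}.
HB.instance Definition _ := SubType.on biop_ring.
HB.instance Definition _ := [Choice of biop_ring by <:].
HB.instance Definition _ := [SubChoice_isSubZmodule of biop_ring by <:].
Local Notation C := biop_ring.

Lemma biop_ringP (f : C) : exists s, val f = biop s.
Proof. exact/biop_predP/valP. Qed.

Lemma biop_one_subproof : @id U \in biop_pred.
Proof.
apply/biop_predP; exists [:: (1, 1)]; apply: funext => w.
by rewrite /biop big_seq1 rmorph1 mul1r mulr1.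
Qed.
Lemma biop_mul_subproof (f g : C) : val f \o val g \in biop_pred.
Proof.
have [[s sE] [t tE]] := (biop_ringP f, biop_ringP g).
apply/biop_predP; exists [seq (q.1 * r.1, r.2 * q.2) | q <- s, r <- t].
apply: funext => w; rewrite /= sE tE /biop big_allpairs_dep.
apply: eq_bigr => q _; rewrite mulr_sumr mulr_suml; apply: eq_bigr => r _.
by rewrite !rmorphM !mulrA.
Qed.
Definition biop_one : C := Sub (@id U) biop_one_subproof.
Definition biop_mul (f g : C) : C := Sub (val f \o val g) (biop_mul_subproof f g).

Lemma biop_mulA : associative biop_mul.
Proof. by move=> f g h; apply: val_inj. Qed.
Lemma biop_mulC : commutative biop_mul.
Proof.
move=> f g; apply: val_inj; apply: funext => w.
have [[s sE] [t tE]] := (biop_ringP f, biop_ringP g).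
by rewrite !SubK /= sE tE biopC.
Qed.
Lemma biop_mul1 : left_id biop_one biop_mul.
Proof. by move=> f; apply: val_inj; rewrite SubK SubK. Qed.
Lemma biop_mulDl : left_distributive biop_mul +%R.
Proof. by move=> f g h; apply: val_inj. Qed.
HB.instance Definition _ := GRing.Zmodule_isComPzRing.Build C
  biop_mulA biop_mulC biop_mul1 biop_mulDl.

Lemma biop_valD (f g : C) w : val (f + g) w = val f w + val g w.
Proof. by []. Qed.
Lemma biop_valM (f g : C) w : val (f * g) w = val f (val g w).
Proof. by []. Qed.

Lemma lmul_subproof (a : A) : *%R (val a) \in biop_pred.
Proof.
apply/biop_predP; exists [:: (a, 1)]; apply: funext => w.
by rewrite /biop big_seq1 rmorph1 mulr1.
Qed.
Definition lmul (a : A) : C := Sub ( *%R (val a)) (lmul_subproof a).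
Lemma lmulE a w : val (lmul a) w = val a * w. Proof. by []. Qed.
Lemma lmul_is_zmod_morphism : zmod_morphism lmul.
Proof. by move=> a b; apply: val_inj; apply: funext => w; rewrite lmulE rmorphB mulrBl. Qed.
Lemma lmul_is_monoid_morphism : monoid_morphism lmul.
Proof.
split=> [|a b]; apply: val_inj; apply: funext => w; rewrite lmulE.
  by rewrite rmorph1 mul1r.
by rewrite rmorphM -mulrA.
Qed.
HB.instance Definition _ := GRing.isZmodMorphism.Build A C lmul lmul_is_zmod_morphism.
HB.instance Definition _ := GRing.isMonoidMorphism.Build A C lmul lmul_is_monoid_morphism.

Lemma rmul_subproof (a : A) : (fun w => w * val a) \in biop_pred.
Proof.
apply/biop_predP; exists [:: (1, a)]; apply: funext => w.
by rewrite /biop big_seq1 rmorph1 mul1r.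
Qed.
Definition rmul (a : A) : C := Sub (fun w => w * val a) (rmul_subproof a).
Lemma rmulE a w : val (rmul a) w = w * val a. Proof. by []. Qed.
Lemma rmul_is_zmod_morphism : zmod_morphism rmul.
Proof. by move=> a b; apply: val_inj; apply: funext => w; rewrite rmulE rmorphB mulrBr. Qed.
Lemma rmul_is_monoid_morphism : monoid_morphism rmul.
Proof.
split=> [|a b]; apply: val_inj; apply: funext => w; rewrite rmulE.
  by rewrite rmorph1 mulr1.
(* Right multiplication reverses products; commutativity of Gamma restores the order. *)
by rewrite mulrC rmorphM mulrA.
Qed.
HB.instance Definition _ := GRing.isZmodMorphism.Build A C rmul rmul_is_zmod_morphism.
HB.instance Definition _ := GRing.isMonoidMorphism.Build A C rmul rmul_is_monoid_morphism.

Lemma in_GuGP u x : in_GuG G u x <-> exists f : C, val f u = x.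
Proof.
split=> [[s [sG ->]]|[f <-]].
  have [t tE] : exists t, \sum_(q <- s) q.1 * u * q.2 = biop t u.
    elim: s sG => [|[a b] s IH] sG; first by exists [::]; rewrite /biop !big_nil.
    have [|t tE] := IH; first by move=> q qs; apply: sG; rewrite inE qs orbT.
    have /= [/subalg_lift[a' aE] /subalg_lift[b' bE]] := sG _ (mem_head _ _).
    by exists ((a', b') :: t); rewrite /biop !big_cons tE /= aE bE.
  have tP : biop t \in biop_pred by apply/biop_predP; exists t.
  by exists (Sub (biop t) tP); rewrite SubK.
have [s ->] := biop_ringP f; exists [seq (val q.1, val q.2) | q <- s].
rewrite big_map; split=> // _ /mapP[q _ ->].
by split; apply: subalg_valP.
Qed.

Lemma in_GuG_lift u vs : (forall y, y \in vs -> in_GuG G u y) ->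
  exists fs : seq C, vs = [seq val f u | f : C <- fs].
Proof.
elim: vs => [|v vs IH] vsG; first by exists [::].
have [|fs ->] := IH; first by move=> y yv; apply: vsG; rewrite inE yv orbT.
by have /in_GuGP[f <-] := vsG v (mem_head _ _); exists (f :: fs).
Qed.

(** The lifted coefficients are indexed by [nat], with value 0 from [n] on, to fit [span_sum]. *)
Lemma subalg_lift_ord n (c : 'I_n -> U) : (forall i, G (c i)) ->
  exists a : nat -> A, forall i : 'I_n, val (a i) = c i.
Proof.
move=> Gc; have /choice[a aE] : forall i, exists a : A, forall lt_in : (i < n)%N,
    val a = c (Ordinal lt_in).
  move=> i; have [lt_in|nlt_in] := pselect (i < n)%N; last by exists 0 => lt_in; case: nlt_in.
  have [a aE] := subalg_lift (Gc (Ordinal lt_in)).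
  by exists a => lt_in'; rewrite aE (bool_irrelevance lt_in lt_in').
by exists a => -[i lt_in].
Qed.

Lemma biop_val_sum u n (F : 'I_n -> C) : val (\sum_i F i) u = \sum_i val (F i) u.
Proof. by apply: (big_morph (fun f : C => val f u)) => // f g; apply: biop_valD. Qed.

(** Evaluation at [u] maps [C] onto the bimodule generated by [u], turns [lmul] into left
    multiplication, and has its kernel inside [I]. Preimages of bimodule generators therefore
    generate [C] modulo [I]. *)
Lemma finite_mod_lmul u (I : C -> Prop) :
  (forall f, val f u = 0 -> I f) -> fg_left G u -> finite_mod lmul I.
Proof.
move=> I0 [vs [/in_GuG_lift[fs ->] span_vs]]; exists fs => f.
have [c [/subalg_lift_ord[a aE] fE]] := span_vs _ (iffRL (in_GuGP u _) (ex_intro _ f erefl)).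
apply: (span_sum (c := a)); apply: I0.
rewrite -[LHS]/(val f u - val (\sum_(i < size fs) lmul (a i) * fs`_i) u).
apply/eqP; rewrite subr_eq0 biop_val_sum fE; apply/eqP.
rewrite (eq_bigr (fun i : 'I__ => val (a i) * [seq val f u | f : C <- fs]`_i)) => [|i _]; last by rewrite aE.
rewrite -(big_mkord xpredT (fun i => val (a i) * [seq val f u | f : C <- fs]`_i)) size_map big_mkord.
by apply: eq_bigr => i _; rewrite (nth_map 0).
Qed.

Lemma finite_mod_rmul u (I : C -> Prop) :
  (forall f, val f u = 0 -> I f) -> fg_right G u -> finite_mod rmul I.
Proof.
move=> I0 [vs [/in_GuG_lift[fs ->] span_vs]]; exists fs => f.
have [c [/subalg_lift_ord[a aE] fE]] := span_vs _ (iffRL (in_GuGP u _) (ex_intro _ f erefl)).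
apply: (span_sum (c := a)); apply: I0.
rewrite -[LHS]/(val f u - val (\sum_(i < size fs) rmul (a i) * fs`_i) u).
apply/eqP; rewrite subr_eq0 biop_val_sum fE; apply/eqP.
rewrite (eq_bigr (fun i : 'I__ => [seq val f u | f : C <- fs]`_i * val (a i))) => [|i _]; last by rewrite aE.
rewrite -(big_mkord xpredT (fun i => [seq val f u | f : C <- fs]`_i * val (a i))) size_map big_mkord.
by apply: eq_bigr => i _; rewrite (nth_map 0).
Qed.

(** * Torsion submodules of a [U]-module *)

Section Modules.
Variable M : lmodType U.
Implicit Types (x y : M) (p q : U -> Prop).

(** The quantifier over [b] makes this an ideal: killing [x] alone would not be preserved when [f]
    is composed with a right multiplication. *)
Definition biop_ann (u : U) x (f : C) := forall b : A, (val f u * val b) *: x = 0.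

Lemma biop_ann_ideal u x : ideal (biop_ann u x).
Proof.
split=> [b|f g fx gx b|g f fx b]; first by rewrite mul0r scale0r.
  by rewrite biop_valD mulrDl scalerDl fx gx addr0.
rewrite biop_valM; have [s ->] := biop_ringP g.
rewrite mulr_suml scaler_suml big1 // => q _.
by rewrite -!mulrA -scalerA (fx (q.2 * b)) scaler0.
Qed.

Lemma t_U_stable i u x : fg_left G u -> fg_right G u -> t_ G i x -> t_ G i (u *: x).
Proof.
move=> fgl fgr [N [[_ _ _] suppN Nx]].
have ann0 f : val f u = 0 -> biop_ann u x f by move=> fu0 b; rewrite fu0 mul0r scale0r.
(* The witness consists of the [y] killed by the left annihilator of [u] Gamma [x]. Its support lies
   among the primes containing that annihilator. *)
exists (fun y => forall a : A, biop_ann u x (lmul a) -> val a *: y = 0); split.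
- split=> [a _|y z Ny Nz a an|g y /subalg_lift[b <-] Ny a an]; first by rewrite scaler0.
    by rewrite scalerDr Ny // Nz // addr0.
  by rewrite scalerA -rmorphM mulrC rmorphM -scalerA Ny ?scaler0.
- move=> p prp [y [Ny locy]]; apply/inZ_cohlt; split=> //.
  apply: (cohlt_bimodule (biop_ann_ideal u x) (finite_mod_lmul ann0 fgl) (finite_mod_rmul ann0 fgr)).
  (* Gamma is commutative, so any [a] killing [x] also satisfies [u * a * b *: x = 0] for all [b].
     Thus [q] contains the annihilator of [x] and belongs to the support of [N]. *)
  + move=> q prq annq; rewrite -(ideal_outK q).
    have /inZ_cohlt[//] : inZ G i (ideal_out q).
    apply: suppN; first exact: prime_out.
    exists x; split=> // _ /subalg_lift[a <-] nqa ax0; apply: nqa.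
    exists a => //; apply: annq => b.
    by rewrite rmulE -mulrA -rmorphM mulrC rmorphM mulrA -scalerA ax0 scaler0.
  + exact: prime_in.
  + move=> a an; apply: contrapT => npa.
    by apply: (locy _ (subalg_valP a) npa); apply: Ny.
- by move=> a /(_ 1); rewrite rmorph1 mulr1 lmulE scalerA.
Qed.

Lemma t_0 i : t_ G i (0 : M).
Proof.
exists (fun y => y = 0); split=> // [|p [_ np1 _] [y [-> loc0]]].
  by split=> [//|x y -> ->|a x _ ->]; rewrite ?addr0 ?scaler0.
by case: Gsub => G1 _ _ _; case: (loc0 1 G1 np1); rewrite scaler0.
Qed.

Lemma t_D i x y : t_ G i x -> t_ G i y -> t_ G i (x + y).
Proof.
move=> [N [[N0 ND NZ] suppN Nx]] [N' [[N'0 N'D N'Z] suppN' N'y]].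
exists (fun z => exists x' y', [/\ N x', N' y' & z = x' + y']); split; last by exists x, y.
  split=> [|_ _ [a [b [Na N'b ->]]] [c [d [Nc N'd ->]]]|g _ Gg [a [b [Na N'b ->]]]].
  - by exists 0, 0; rewrite addr0.
  - by exists (a + c), (b + d); split; [apply: ND | apply: N'D | rewrite addrACA].
  - by exists (g *: a), (g *: b); split; [apply: NZ | apply: N'Z | rewrite scalerDr].
move=> p prp [_ [[a [b [Na N'b ->]]] loc]].
have [/suppN|nN] := pselect (loc_nonzero G N p); first exact.
have [/suppN'|nN'] := pselect (loc_nonzero G N' p); first exact.
exfalso.
(* If both summands vanish in the localization at [p], the product of their two killers is outside
   the prime [p] and kills the sum. *)
have kill (L : M -> Prop) z : ~ loc_nonzero G L p -> L z -> exists s, [/\ G s, ~ p s & s *: z = 0].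
  move=> nL Lz; apply: contrapT => no; apply: nL; exists z; split=> // s Gs nps sz.
  by apply: no; exists s.
have [s [Gs nps sa]] := kill _ _ nN Na; have [r [Gr npr rb]] := kill _ _ nN' N'b.
have [_ _ pP] := prp; have [_ _ GM _] := Gsub.
apply: (loc (s * r)); [exact: GM | by case/(pP _ _ Gs Gr) |].
by rewrite scalerDr {1}(Gcomm Gs Gr) -!scalerA sa rb !scaler0 addr0.
Qed.

Lemma t_mono i j x : (i <= j)%N -> t_ G i x -> t_ G j x.
Proof.
move=> /subnKC<- [N [subN suppN Nx]]; exists N; split=> // p prp /(suppN p prp).
by elim: (j - i)%N => [|d IH]; rewrite ?addn0 // addnS => /IH; left.
Qed.

Lemma annihilator_neq0 x q : is_prime G q -> (forall g, q g <-> (G g /\ g *: x = 0)) -> x <> 0.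
Proof.
move=> [_ nq1 _] qE x0; apply: nq1; apply/qE; split; first by case: Gsub.
by rewrite x0 scaler0.
Qed.

(** The element [x] survives localization at [q], which gives one direction. For the other, the
    elements killed by [q] form a submodule whose support lies above [q], and [inZ G i] is closed
    upwards among primes. *)
Lemma t_annihilator i x q : is_prime G q ->
  (forall g, q g <-> (G g /\ g *: x = 0)) -> t_ G i x <-> inZ G i q.
Proof.
move=> prq qE; split=> [[N [_ suppN Nx]]|qZ].
  by apply: suppN => //; exists x; split=> // s Gs nqs sx; apply: nqs; apply/qE.
exists (fun y => forall g, q g -> g *: y = 0); split; last by move=> g /qE[].
  split=> [g _|y z qy qz g qg|a y Ga qy g qg]; first by rewrite scaler0.
    by rewrite scalerDr qy // qz // addr0.
  have [Gg _] := iffLR (qE g) qg.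
  by rewrite scalerA (Gcomm Gg Ga) -scalerA qy // scaler0.
move=> p prp [y [qy loc]]; apply: inZ_up qZ _ => // g qg.
have [Gg _] := iffLR (qE g) qg.
by apply: contrapT => npg; apply: (loc g) => //; apply: qy.
Qed.

End Modules.

End CommutativeSubalgebra.

(** * Liftability, and the torsion level of a simple module *)

Theorem theorem3p3 (K : closedFieldType) (U : algType K) (G : U -> Prop) :
  [pchar K] =i pred0 ->
  is_subalg G -> comm_on G ->
  (exists s : seq U, gen_by (fun x => x \in s) G) ->
  (exists us : seq U, gen_by (fun x => G x \/ x \in us) (fun _ => True)) ->
  (forall u : U, fg_left G u /\ fg_right G u) ->
  (forall i : nat, liftable G i) /\
  (forall M : lmodType U, simple_mod M ->
     exists i : nat,
       ((forall x : M, t_ G i x) /\ (forall x : M, t_prev G i x -> x = 0) /\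
        (forall p, Ass M G p -> coheight G p i)) /\
       (forall j : nat, (forall x : M, t_ G j x) ->
                        (forall x : M, t_prev G j x -> x = 0) -> j = i)).
Proof.
move=> _ Gsub Gcomm [s genG] _ fg.
have lift_t i : liftable G i.
  move=> M; split; [exact: t_0 | by move=> x y; apply: t_D |].
  by move=> u x; have [fgl fgr] := fg u; apply: t_U_stable.
split=> // M [[x0 x0n0] simpleM].
(* By liftability each torsion part is a [U]-submodule, so simplicity makes it zero or all of
   [M]. *)
have tM i (x : M) : t_ G i x -> x <> 0 -> forall y : M, t_ G i y.
  by move=> tx nx; case: (simpleM _ (lift_t i M)) => // /(_ x tx).
have t_top (x : M) : t_ G (size s) x.
  exists (fun=> True); split=> // p prp _.
  exact: inZ_bounded genG _ prp.
have exi : exists i, `[< exists2 x : M, t_ G i x & x <> 0 >].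
  by exists (size s); apply/asboolP; exists x0.
(* The level sought is the least one with nonzero torsion part; it exists because every prime lies
   in [inZ G (size s)]. *)
have [i /asboolP[x tx nx] mini] := ex_minnP exi.
have low j (y : M) : (j < i)%N -> t_ G j y -> y = 0.
  move=> ji ty; apply: contrapT => ny.
  by move: ji; rewrite ltnNge mini //; apply/asboolP; exists y.
exists i; split; [split; [exact: tM tx nx | split] |].
- by case: (i) low => [|j] low y //=; apply: low.
(* The element [y] is torsion at level [i], so [p] is in [inZ G i]; membership at a lower level
   would make [y] torsion there, hence zero. *)
- move=> p [prp [y yE]]; have ny := annihilator_neq0 Gsub prp yE.
  split; first by apply/(t_annihilator Gsub Gcomm _ prp yE); apply: tM tx nx y.
  by move=> j ji /(t_annihilator Gsub Gcomm _ prp yE) /(low _ _ ji).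
(* If [j] exceeded [i], the torsion part at level [j - 1] would contain that at level [i], which is
   all of [M]. Conversely, [j] cannot be smaller, by minimality of [i]. *)
- move=> j tj tpj; apply/eqP; rewrite eqn_leq; apply/andP; split.
    case: j tpj {tj} => //= j tpj; rewrite ltnNge; apply/negP => ij.
    by apply: x0n0; apply: tpj; apply: t_mono ij _; apply: tM tx nx _.
  by apply: mini; apply/asboolP; exists x0.
Qed.
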